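(* For $n\ge 1$ let $t_n$ be the arbor of size $n$ consisting of a root vertex with one element and $n-1$ child vertices, each a leaf with one element, and let $Z_{t_n}(u,X)$ be the (extended) Zeta polynomial of the poset $P_{t_n}$. Then, as formal power series in $s$ with coefficients in $\mathbb{Q}[u]$, $$1+\sum_{n\ge 1} Z_{t_n}(u,1)\,s^n=\exp\left(\int \frac{u}{(1-us)(1+s-us)}\,ds\right)=\left(\frac{1-su+s}{1-su}\right)^u,$$ where $\int\cdot\,ds$ denotes the formal antiderivative with respect to $s$ that vanishes at $s=0$.
   Context: An arbor $t$ of size $n$ is a rooted tree in which each vertex $v$ is decorated by a non-empty subset of $[n]=\{1,\dots,n\}$, these subsets forming a partition of $[n]$. For a vertex $v$, $\mathcal{D}(v)\subseteq[n]$ is the set of all labels occurring in the sub-tree rooted at $v$ (that is, at $v$ and its descendants). The polytope $Q_t\subset\mathbb{R}^n$ is defined by $x_i\ge 0$ for all $i\in[n]$ and $\sum_{i\in\mathcal{D}(v)}x_i\le|\mathcal{D}(v)|$ for every vertex $v$. The poset $P_t$ is the set of lattice points $Q_t\cap\mathbb{Z}^n$ with $x\le y$ iff $x_i\le y_i$ for all $i$; it is graded by the height $\mathrm{ht}(x)=\sum_i x_i$. For the arbor $t_n$ (labelling the root by $\{n\}$ and the leaves by $\{1\},\dots,\{n-1\}$; $t_1$ is a single vertex), the defining inequalities are $x_i\ge0$ for $1\le i\le n$, $x_i\le 1$ for $1\le i\le n-1$, and $x_1+\cdots+x_n\le n$. The polynomial $Z_t(u,X)$ in $u$ and $X$ is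 the unique polynomial such that for every integer $m\ge2$, $$Z_t(m,X)=\sum_{e_1\le e_2\le\cdots\le e_{m-1}}X^{\mathrm{ht}(e_{m-1})},$$ the sum being over all multichains (weakly increasing sequences) of $m-1$ elements of $P_t$. Setting $X=1$ gives the classical Zeta polynomial of $P_t$. For a formal power series $f(s)$ with constant term $1$, $f(s)^u$ means $\exp(u\log f(s))$. *)

(* Defs.v *)
From mathcomp Require Import all_boot all_order all_algebra.

Set Implicit Arguments.
Unset Strict Implicit.
Unset Printing Implicit Defensive.

Import Order.TTheory GRing.Theory Num.Theory.
Local Open Scope ring_scope.

(* Arbors. The label set [n] = {1, .., n} is rendered as 'I_n = {0, .., n-1}. *)

(* The children are listed in some order; nothing below depends on it. *)
Inductive tree (n : nat) : Type := Node of {set 'I_n} & seq (tree n).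

Definition deco n (t : tree n) : {set 'I_n} := let: Node A _ := t in A.

(* One entry per vertex v: the sub-tree rooted at v. *)
Fixpoint subtrees n (t : tree n) : seq (tree n) :=
  let: Node _ ts := t in t :: flatten (map (@subtrees n) ts).

Definition decorations n (t : tree n) : seq {set 'I_n} :=
  [seq deco v | v <- subtrees t].

(* [partition] excludes empty blocks; [uniq] excludes two vertices carrying
   the same (non-empty) block. *)
Definition is_arbor n (t : tree n) : bool :=
  uniq (decorations t) && partition [set:: decorations t] [set: 'I_n].

Record arbor (n : nat) := Arbor { tree_of :> tree n; arborP : is_arbor tree_of }.

Definition labels_below n (v : tree n) : {set 'I_n} :=
  \bigcup_(A <- decorations v) A.

(* With R a field of real numbers this is Q_t; with R = int it is the set of
   lattice points of Q_t, see [polytope_intr]. *)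
Definition polytope (R : numDomainType) n (t : arbor n) : pred 'rV[R]_n :=
  fun x => [forall i, 0 <= x 0 i] &&
    all (fun v => \sum_(i in labels_below v) x 0 i <= #|labels_below v|%:R)
        (subtrees t).

Lemma polytope_intr (R : numDomainType) n (t : arbor n) (x : 'rV[int]_n) :
  polytope t (map_mx intr x : 'rV[R]_n) = polytope t x.
Proof.
congr (_ && _); first by apply: eq_forallb => i; rewrite mxE ler0z.
apply: eq_all => v.
rewrite (eq_bigr (fun i => (x 0 i)%:~R)) => [|i _]; last by rewrite mxE.
by rewrite -(rmorph_sum (intr : int -> R)) /= -(rmorph_nat (intr : int -> R)) ler_int.
Qed.

Definition coords n (x : {ffun 'I_n -> 'I_n.+1}) : 'rV[int]_n :=
  \row_i (x i : nat)%:Z.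

(* All lattice points of Q_t lie in the box {0, .., n}^n, see
   [lattice_point_coords]; hence the following is a finType. *)
Definition lattice_point n (t : arbor n) :=
  {x : {ffun 'I_n -> 'I_n.+1} | polytope t (coords x)}.

Lemma lattice_point_coords n (t : arbor n) (y : 'rV[int]_n) :
  polytope t y -> exists x : lattice_point t, y = coords (val x).
Proof.
move=> yQ; have /andP[/forallP y0 yD] := yQ.
have rootT : labels_below t = [set: 'I_n].
  have /andP[_ /and3P[/eqP cov _ _]] := arborP t.
  apply/eqP; rewrite -subTset -cov; apply/subsetP => i /bigcupP[A].
  rewrite inE => At iA; rewrite /labels_below big_tnth.
  have lt : (index A (decorations t) < size (decorations t))%N by rewrite index_mem.
  by apply/bigcupP; exists (Ordinal lt) => //; rewrite (tnth_nth set0) /= nth_index.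
have {yD} : \sum_(i in labels_below t) y 0 i <= #|labels_below t|%:R.
  by move: yD; case: (tree_of t) => A ts /= /andP[].
rewrite rootT cardsT card_ord => le_n.
have {}le_n : \sum_i y 0 i <= n%:R.
  by rewrite (eq_bigl (fun i => i \in [set: 'I_n])) // => i; rewrite inE.
rewrite natz in le_n.
have yn i : (absz (y 0%R i) < n.+1)%N.
  rewrite ltnS -lez_nat gez0_abs //; apply: le_trans _ le_n.
  by rewrite (bigD1 i) //= lerDl sumr_ge0.
pose x := [ffun i => Ordinal (yn i)].
have xy : y = coords x.
  by apply/rowP => i; rewrite mxE ffunE /= gez0_abs.
have xQ : polytope t (coords x) by rewrite -xy.
by exists (exist _ x xQ).
Qed.

Definition lattice_le n (t : arbor n) : rel (lattice_point t) :=
  fun x y => [forall i, (val x i <= val y i)%N].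

Definition height n (t : arbor n) (x : lattice_point t) : nat :=
  (\sum_i val x i)%N.

(* Q[u][X] : 'X is the variable X of Z_t(u, X) and the coefficients are
   polynomials in u. With m = k + 2, e_1 <= .. <= e_{m-1} is a (k+1)-tuple. *)
Definition is_zeta n (t : arbor n) (Z : {poly {poly rat}}) : Prop :=
  forall k : nat,
    map_poly (horner_eval (k.+2%:R : rat)) Z =
    \sum_(e : k.+1.-tuple (lattice_point t) | sorted (@lattice_le n t) e)
      'X^(height (tnth e ord_max)).

Section ZetaExists.
Variables (T : finType) (le : rel T) (ht : T -> nat).
Hypothesis le_refl : reflexive le.
Hypothesis ht_lt : forall x y, le x y -> x != y -> (ht x < ht y)%N.

(* number of multichains of k + 1 elements with greatest element x *)
Fixpoint nb_chains (k : nat) (x : T) : nat :=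
  if k is k'.+1 then (\sum_(y | le y x) nb_chains k' y)%N else 1%N.

Lemma tnth_rcons_max k (e : k.+1.-tuple T) x :
  tnth [tuple of rcons e x] ord_max = x.
Proof. by rewrite (tnth_nth x) /= nth_rcons size_tuple ltnn eqxx. Qed.

Lemma chain_sum (V : nmodType) k (F : T -> V) :
  \sum_(e : k.+1.-tuple T | sorted le e) F (tnth e ord_max) =
  \sum_x F x *+ nb_chains k x.
Proof.
elim: k F => [|k IH] F.
  rewrite (reindex (fun x : T => [tuple x])) /=; last first.
    exists (fun e : 1.-tuple T => thead e) => [x _ //|e _].
    by case/tupleP: e => x e; apply: val_inj; rewrite /= (tuple0 e).
  by apply: eq_bigr => x _; rewrite mulr1n.
pose h (p : k.+1.-tuple T * T) : k.+2.-tuple T := [tuple of rcons p.1 p.2].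
pose g (e : k.+2.-tuple T) : k.+1.-tuple T * T :=
  ([tuple of belast (thead e) (behead e)], last (thead e) (behead e)).
have ge e : tval e = rcons (g e).1 (g e).2.
  by rewrite /= -lastI; rewrite {1}(tuple_eta e).
rewrite (reindex h) /=; last first.
  exists g => [[e x] _|e _]; last by apply: val_inj; rewrite [RHS]ge.
  have := ge (h (e, x)); rewrite {1}/h /= => /eqP.
  rewrite eqseq_rcons => /andP[/eqP E /eqP E'].
  by rewrite /g; congr (_, _) => //; apply: val_inj.
transitivity (\sum_(e : k.+1.-tuple T | sorted le e)
    \sum_(x | le (tnth e ord_max) x) F x).
  rewrite pair_big_dep /=; apply: eq_big => [[e x]|[e x] _] /=; last first.
    by rewrite tnth_rcons_max.
  case/tupleP: e => a e; rewrite /= rcons_path; congr (_ && le _ _).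
  by rewrite (tnth_nth a) /= (last_nth a) size_tuple.
rewrite (IH (fun y => \sum_(x | le y x) F x)) /=.
under eq_bigr => y _ do rewrite -sumrMnl.
rewrite (exchange_big_dep xpredT) //=.
by apply: eq_bigr => x _; rewrite sumrMnr.
Qed.

Lemma antidifference (q : {poly rat}) :
  {p : {poly rat} | forall k, p.[k.+1%:R] - p.[k%:R] = q.[k%:R]}.
Proof.
elim: (size q) {-2}q (leqnn (size q)) => [|d IH] {}q.
  rewrite leqn0 size_poly_eq0 => /eqP->; exists 0 => k.
  by rewrite !horner0 subrr.
move=> sq; pose D : {poly rat} := ('X + 1) ^+ d.+1 - 'X^(d.+1).
have cD i : D`_i = 'C(d.+1, i)%:R *+ (i < d.+1)%N.
  rewrite coefB coefXn exprD1n.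
  rewrite (eq_bigr (fun j : 'I_d.+2 => 'C(d.+1, j)%:R *: 'X^j)); last first.
    by move=> j _; rewrite scaler_nat.
  rewrite -(poly_def d.+2 (fun j => 'C(d.+1, j)%:R)) coef_poly ltnS.
  by case: ltngtP => [_|_|->]; rewrite ?binn ?subr0 ?subrr.
pose r := q`_d / d.+1%:R.
have [|p pP] := IH (q - r *: D).
  apply/leq_sizeP => j; rewrite leq_eqVlt coefB coefZ cD => /orP[/eqP<-|dj].
    by rewrite ltnSn mulr1n binSn divfK ?subrr // pnatr_eq0.
  by rewrite ltnS leqNgt dj mulr0 subr0; apply/leq_sizeP: dj.
exists (p + r *: 'X^(d.+1)) => k.
have := pP k; rewrite /D !(hornerE, hornerXn) natr1 => /(canRL (subrK _)) E.
by rewrite opprD addrACA -mulrBr E addrK subrK.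
Qed.

Lemma nb_chains_poly :
  {p : T -> {poly rat} | forall k x, (p x).[k.+2%:R] = (nb_chains k x)%:R}.
Proof.
suff H d : {p : T -> {poly rat} |
    forall x, (ht x < d)%N -> forall k, (p x).[k.+2%:R] = (nb_chains k x)%:R}.
  have [p pP] := H (\max_x ht x).+1; exists p => k x; apply: pP.
  by rewrite ltnS (leq_bigmax x).
elim: d => [|d [p pP]]; first by exists (fun=> 0).
pose a x := antidifference (\sum_(y | le y x && (y != x)) p y).
have [b bP] : {b : T -> {poly rat} | forall x k,
    (b x).[k.+1%:R] - (b x).[k%:R] = (\sum_(y | le y x && (y != x)) p y).[k%:R]}.
  by exists (fun x => sval (a x)) => x; exact: svalP (a x).
exists (fun x => b x + (1 - (b x).[2%:R])%:P) => x xd.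
elim=> [|k IH]; first by rewrite hornerD hornerC addrCA subrr addr0.
rewrite /= (bigD1 x) ?le_refl //= natrD -IH natr_sum !hornerD !hornerC.
rewrite (canRL (subrK _) (bP x k.+2)) -addrA addrC; congr (_ + _).
rewrite horner_sum; apply: eq_bigr => y /andP[yx nyx]; apply: pP.
by rewrite (leq_trans (ht_lt yx nyx)).
Qed.

Lemma zeta_exists_gen :
  {Z : {poly {poly rat}} | forall k : nat,
    map_poly (horner_eval (k.+2%:R : rat)) Z =
    \sum_(e : k.+1.-tuple T | sorted le e) 'X^(ht (tnth e ord_max))}.
Proof.
have [p pP] := nb_chains_poly.
exists (\sum_x (p x)%:P * 'X^(ht x)) => k.
rewrite (chain_sum k (fun x => 'X^(ht x))) rmorph_sum /=.
apply: eq_bigr => x _.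
rewrite rmorphM /= map_polyXn map_polyC /= /horner_eval pP.
by rewrite polyC_natr mulr_natl.
Qed.

End ZetaExists.

Lemma lattice_le_refl n (t : arbor n) : reflexive (@lattice_le n t).
Proof. by move=> x; apply/forallP. Qed.

Lemma height_lt n (t : arbor n) (x y : lattice_point t) :
  lattice_le x y -> x != y -> (height x < height y)%N.
Proof.
move=> /forallP xy; apply: contraR; rewrite -leqNgt => yx.
have /leqif_sum[_] : forall i : 'I_n, true ->
    (val x i <= val y i ?= iff (val x i == val y i :> nat))%N.
  by move=> i _; split; rewrite ?xy.
have -> : (\sum_i val x i == \sum_i val y i)%N.
  by rewrite eqn_leq yx leq_sum.
move/esym/forallP => E; apply/eqP/val_inj/ffunP => i; apply/val_inj/eqP.
exact: (implyP (E i)).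
Qed.

Lemma zeta_exists n (t : arbor n) : {Z | is_zeta t Z}.
Proof. exact: zeta_exists_gen (@lattice_le_refl n t) (@height_lt n t). Qed.

Lemma zeta_unique n (t : arbor n) Z Z' : is_zeta t Z -> is_zeta t Z' -> Z = Z'.
Proof.
move=> ZP ZP'; apply/polyP => i; apply/eqP; rewrite -subr_eq0; apply/eqP.
set p := _ - _; pose s := [seq (k.+2%:R : rat) | k <- iota 0 (size p)].
apply: (@roots_geq_poly_eq0 _ _ s); last by rewrite size_map size_iota.
  apply/allP => _ /mapP[k _ ->]; rewrite rootE /p hornerD hornerN subr_eq0.
  have := congr1 (fun q : {poly rat} => q`_i) (etrans (ZP k) (esym (ZP' k))).
  by rewrite !coef_map /= /horner_eval => ->.
rewrite map_inj_uniq ?iota_uniq // => j k /eqP.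
by rewrite eqr_nat => /eqP[].
Qed.

(* The polynomial Z_t(u, X), as an element of Q[u][X]. *)
Definition zeta_poly n (t : arbor n) : {poly {poly rat}} := sval (zeta_exists t).

Lemma zeta_polyP n (t : arbor n) : is_zeta t (zeta_poly t).
Proof. exact: (svalP (zeta_exists t)). Qed.

(* The tree t_{k+1}: in 'I_k.+1 the label k+1 of the root is [ord_max], and
   the labels 1, .., k of the leaves are the [lift ord_max i] for i : 'I_k. *)
Definition corolla_tree (k : nat) : tree k.+1 :=
  Node [set ord_max] [seq Node [set lift ord_max i] [::] | i <- enum 'I_k].

Lemma corolla_decorations k :
  decorations (corolla_tree k) =
  [set ord_max] :: [seq [set lift ord_max i] | i <- enum 'I_k].
Proof.
rewrite /decorations /=; congr (_ :: _).
by elim: (enum 'I_k) => //= i r ->.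
Qed.

Lemma corolla_is_arbor k : is_arbor (corolla_tree k).
Proof.
have decoE : [set:: decorations (corolla_tree k)] = [set [set i] | i : 'I_k.+1].
  apply/setP => A; rewrite corolla_decorations.
  rewrite [LHS]inE in_cons; apply/orP/imsetP.
    by case=> [/eqP->|/mapP[i _ ->]]; eexists.
  case=> i _ ->; case: (unliftP ord_max i) => [j|] ->; last by left.
  by right; apply/mapP; exists j; rewrite ?mem_enum.
apply/andP; split.
  rewrite corolla_decorations /= map_inj_uniq ?enum_uniq ?andbT; last first.
    by move=> i j /set1_inj /lift_inj.
  by apply/mapP => -[i _ /set1_inj/eqP]; rewrite (negPf (neq_lift _ _)).
rewrite decoE; apply/and3P; split.
- rewrite eqEsubset subsetT; apply/subsetP => i _; apply/bigcupP.
  by exists [set i]; rewrite ?set11 //; apply/imsetP; exists i.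
- apply/trivIsetP => A B /imsetP[i _ ->] /imsetP[j _ ->] ij.
  by rewrite disjoints1 inE; apply: contra ij => /eqP->.
- by apply/imsetP => -[i _ /setP/(_ i)]; rewrite !inE eqxx.
Qed.

Definition corolla (k : nat) : arbor k.+1 := Arbor (corolla_is_arbor k).

(* Formal power series in s over a commutative Q-algebra, as coefficient
   sequences. *)
Definition fps (A : Type) := nat -> A.

Section FPS.
Variable A : comAlgType rat.
Implicit Types (f g : fps A) (a : A) (n k : nat).

Definition fps_const a : fps A := fun n => if n is 0%N then a else 0.
Definition fps_var : fps A := fun n => (n == 1%N)%:R.
Definition fps_add f g : fps A := fun n => f n + g n.
Definition fps_sub f g : fps A := fun n => f n - g n.
Definition fps_mul f g : fps A := fun n => \sum_(i < n.+1) f i * g (n - i)%N.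
Definition fps_exp_nat f k : fps A := iter k (fps_mul f) (fps_const 1).

(* The sums over k below are truncated at k = n: when the series raised to the
   power k has constant term 0, its k-th power has no term of degree n < k. *)

(* 1/f = \sum_k (1 - f)^k, for f with constant term 1 *)
Definition fps_inv f : fps A := fun n =>
  \sum_(k < n.+1) fps_exp_nat (fps_sub (fps_const 1) f) k n.

(* for f with constant term 0 *)
Definition fps_exp f : fps A := fun n =>
  \sum_(k < n.+1) (k`!%:R^-1 : rat) *: fps_exp_nat f k n.

(* log f = \sum_(k >= 1) (-1)^(k+1) (f - 1)^k / k, for f with constant term 1 *)
Definition fps_log f : fps A := fun n =>
  \sum_(1 <= k < n.+1)
    ((-1) ^+ k.+1 / k%:R : rat) *: fps_exp_nat (fps_sub f (fps_const 1)) k n.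

(* f^a, for f with constant term 1 *)
Definition fps_pow f a : fps A := fps_exp (fps_mul (fps_const a) (fps_log f)).

Definition fps_int f : fps A := fun n =>
  if n is k.+1 then (k.+1%:R^-1 : rat) *: f k else 0.

End FPS.

Declare Scope fps_scope.
Delimit Scope fps_scope with fps.
Bind Scope fps_scope with fps.
Notation "1" := (fps_const 1%R) : fps_scope.
Notation "f + g" := (fps_add f g) : fps_scope.
Notation "f - g" := (fps_sub f g) : fps_scope.
Notation "f * g" := (fps_mul f g) : fps_scope.
Notation "f / g" := (fps_mul f (fps_inv g)) : fps_scope.

(* 1 + \sum_(n >= 1) Z_{t_n}(u, 1) s^n, over Q[u] *)
Definition zeta_series : fps {poly rat} := fun n =>
  if n is k.+1 then (zeta_poly (corolla k)).[1] else 1.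

(* Main.v *)
Require Import Defs.
From HB Require Import structures.
From mathcomp Require Import all_boot all_order all_algebra.
From mathcomp Require Import boolp ring zify.

(* Writing Z_{t_n}(m, 1) as a sum over the top element x of the number
   \prod_i C(x_i + m - 2, m - 2) of multichains of m - 1 elements with top x, one
   finds with p = n - 1
     Z_{t_n}(m, 1) = \sum_j C(p, j) (m - 1)^j C(p - j + m, m - 1),
   which is the coefficient of s^n in (1 - w)^(-m) for w = s / (1 - (m - 1) s).
   With m replaced by u, the series (1 - w)^(-u) and the exponential satisfy the
   same first-order linear equation, because w' = 1 / (1 - (u - 1) s)^2.  The
   second equality holds because the logarithms have the same derivative. *)

Set Implicit Arguments.
Unset Strict Implicit.
Unset Printing Implicit Defensive.

Import Order.TTheory GRing.Theory Num.Theory.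
Local Open Scope ring_scope.

(* An alias of [fps] that escapes the notations of [fps_scope] and carries the
   ring structure; its operations are convertible to those of [fps]. *)
Definition series (A : Type) : Type := fps A.

(** Sequences have no decidable equality, so these structures are classical. *)
HB.instance Definition _ (A : Type) := gen_eqMixin (series A).
HB.instance Definition _ (A : Type) := gen_choiceMixin (series A).

(** * The ring of formal power series *)

Section SeriesRing.
Variable A : comAlgType rat.
Implicit Types (f g h : series A) (n N : nat).

Lemma seriesP f g : f =1 g -> f = g.
Proof. exact: funext. Qed.

Definition series_opp f : series A := fun n => - f n.
Definition series_zero : series A := fun=> 0.

Lemma fps_addA : associative (@fps_add A : series A -> series A -> series A).
Proof. by move=> f g h; apply: seriesP => n; apply: addrA. Qed.

Lemma fps_addC : commutative (@fps_add A : series A -> series A -> series A).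
Proof. by move=> f g; apply: seriesP => n; apply: addrC. Qed.

Lemma fps_add0 : left_id series_zero (@fps_add A).
Proof. by move=> f; apply: seriesP => n; apply: add0r. Qed.

Lemma fps_addN : left_inverse series_zero series_opp (@fps_add A).
Proof. by move=> f; apply: seriesP => n; apply: addNr. Qed.

HB.instance Definition _ :=
  GRing.isZmodule.Build (series A) fps_addA fps_addC fps_add0 fps_addN.

Definition trunc N f : {poly A} := \poly_(i < N) f i.

(** A coefficient of a product involves no coefficient of larger degree, so associativity and
    commutativity can be imported from truncated polynomials. *)
Lemma fps_mul_trunc N f g n : (n < N)%N ->
  fps_mul f g n = (trunc N f * trunc N g)`_n.
Proof.
move=> nN; rewrite coefM; apply: eq_bigr => i _.
rewrite !coef_poly (leq_ltn_trans (leq_subr _ _) nN) ifT //.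
exact: leq_ltn_trans (leq_ord i) nN.
Qed.

Lemma fps_mulA : associative (@fps_mul A : series A -> series A -> series A).
Proof.
move=> f g h; apply: seriesP => n.
transitivity ((trunc n.+1 f * (trunc n.+1 g * trunc n.+1 h))`_n).
  rewrite coefM; apply: eq_bigr => i _.
  by rewrite coef_poly ltn_ord (@fps_mul_trunc n.+1) // ltnS leq_subr.
rewrite mulrA coefM; apply: eq_bigr => i _.
by rewrite (@fps_mul_trunc n.+1) // coef_poly ltnS leq_subr.
Qed.

Lemma fps_mulC : commutative (@fps_mul A : series A -> series A -> series A).
Proof.
by move=> f g; apply: seriesP => n; rewrite !(@fps_mul_trunc n.+1) // mulrC.
Qed.

Lemma fps_mul1 : left_id (fps_const 1) (@fps_mul A).
Proof.
move=> f; apply: seriesP => n; rewrite /fps_mul big_ord_recl /= mul1r subn0.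
by rewrite big1 ?addr0 // => i _; rewrite mul0r.
Qed.

Lemma fps_mulDl : left_distributive (@fps_mul A) (@fps_add A).
Proof.
move=> f g h; apply: seriesP => n; rewrite /fps_mul /fps_add -big_split.
by apply: eq_bigr => i _; apply: mulrDl.
Qed.

Lemma fps_one_neq0 : (fps_const 1 : series A) != 0.
Proof.
by apply/eqP => /(congr1 (fun f : series A => f 0%N))/eqP; rewrite oner_eq0.
Qed.

HB.instance Definition _ := GRing.Zmodule_isComNzRing.Build (series A)
  fps_mulA fps_mulC fps_mul1 fps_mulDl fps_one_neq0.

Lemma seriesM f g n : (f * g) n = \sum_(i < n.+1) f i * g (n - i)%N.
Proof. by []. Qed.

Lemma seriesD f g n : (f + g) n = f n + g n.
Proof. by []. Qed.

Lemma seriesN f n : (- f) n = - f n.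
Proof. by []. Qed.

Lemma seriesB f g n : (f - g) n = f n - g n.
Proof. by []. Qed.

Lemma series_sum I (r : seq I) (P : pred I) (F : I -> series A) n :
  (\sum_(i <- r | P i) F i) n = \sum_(i <- r | P i) F i n.
Proof. exact: (big_morph (fun f : series A => f n)). Qed.

Lemma series0M f g : (f * g) 0%N = f 0%N * g 0%N.
Proof. by rewrite seriesM big_ord1. Qed.

Lemma eq_fps_mulr f g h n : (forall i, (i <= n)%N -> f i = g i) ->
  (f * h) n = (g * h) n.
Proof. by move=> fg; apply: eq_bigr => i _; rewrite fg ?leq_ord. Qed.

Definition sconst (a : A) : series A := fps_const a.

Lemma sconstM a f n : (sconst a * f) n = a * f n.
Proof.
rewrite seriesM big_ord_recl /= subn0.
by rewrite big1 ?addr0 // => i _; rewrite mul0r.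
Qed.

Lemma sconst_is_zmod : zmod_morphism sconst.
Proof. by move=> a b; apply: seriesP => -[|n]; rewrite seriesB //= subr0. Qed.
HB.instance Definition _ := GRing.isZmodMorphism.Build A (series A) sconst
  sconst_is_zmod.

Lemma sconst_is_monoid : monoid_morphism sconst.
Proof.
by split=> // a b; apply: seriesP => -[|n]; rewrite sconstM //= mulr0.
Qed.
HB.instance Definition _ := GRing.isMonoidMorphism.Build A (series A) sconst
  sconst_is_monoid.

Definition svar : series A := fps_var A.

Lemma svarM f n : (svar * f) n = if n is k.+1 then f k else 0.
Proof.
case: n => [|n]; first by rewrite series0M mul0r.
rewrite seriesM big_ord_recl mul0r add0r big_ord_recl mul1r subSS subn0.
by rewrite big1 ?addr0 // => i _; rewrite mul0r.
Qed.

Lemma exp_natE f k : fps_exp_nat f k = f ^+ k :> series A.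
Proof. by elim: k => //= k ->; rewrite exprS. Qed.

(** Constant term 0 makes f divisible by s, hence f^k divisible by s^k. *)
Lemma expr_low f k n : f 0%N = 0 -> (n < k)%N -> (f ^+ k) n = 0.
Proof.
move=> f0; elim: k n => // k IH n nk; rewrite exprS seriesM big1 // => -[i iP] _.
case: i iP => /= [|i] iP; first by rewrite f0 mul0r.
by rewrite IH ?mulr0 //; lia.
Qed.

(** * Formal derivative and linear differential equations *)

Definition sderiv f : series A := fun n => f n.+1 *+ n.+1.

Lemma deriv_is_zmod : zmod_morphism sderiv.
Proof. by move=> f g; apply: seriesP => n; rewrite /sderiv mulrnBl. Qed.
HB.instance Definition _ := GRing.isZmodMorphism.Build (series A) (series A)
  sderiv deriv_is_zmod.

Lemma sderivM f g : sderiv (f * g) = sderiv f * g + f * sderiv g.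
Proof.
apply: seriesP => n; rewrite /sderiv seriesD !seriesM.
transitivity (\sum_(i < n.+2)
    (f i *+ i * g (n.+1 - i)%N + f i * (g (n.+1 - i)%N *+ (n.+1 - i)))).
  rewrite -sumrMnl; apply: eq_bigr => i _.
  by rewrite mulrnAl mulrnAr -mulrnDr subnKC // leq_ord.
rewrite big_split /=; congr (_ + _).
  by rewrite big_ord_recl mulr0n mul0r add0r.
rewrite big_ord_recr /= subnn mulr0n mulr0 addr0.
by apply: eq_bigr => i _; rewrite subSn // leq_ord.
Qed.

Lemma sderiv_const a : sderiv (sconst a) = 0.
Proof. by apply: seriesP => n; rewrite /sderiv mul0rn. Qed.

Lemma sderiv1 : sderiv 1 = 0. Proof. exact: (sderiv_const 1). Qed.

Lemma sderiv_var : sderiv svar = 1.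
Proof.
by apply: seriesP => -[|n]; rewrite /sderiv ?mulr1n // mul0rn.
Qed.

Lemma sderiv_exp f k : sderiv (f ^+ k.+1) = f ^+ k * sderiv f *+ k.+1.
Proof.
elim: k => [|k IH]; first by rewrite mul1r.
by rewrite exprS sderivM IH mulrnAr mulrA -exprS [RHS]mulrS mulrC.
Qed.

Lemma mulrSnI (a b : A) n : a *+ n.+1 = b *+ n.+1 -> a = b.
Proof.
move=> /(congr1 (fun c => (n.+1%:R^-1 : rat) *: c)).
by rewrite -!scaler_nat !scalerA mulVf ?pnatr_eq0 // !scale1r.
Qed.

Lemma sderiv_inj f g : f 0%N = g 0%N -> sderiv f = sderiv g -> f = g.
Proof.
move=> fg0 /(congr1 (fun h : series A => h _)) fg; apply: seriesP => -[|n] //.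
exact: (mulrSnI (fg n)).
Qed.

(* A first-order linear equation determines each coefficient from the previous
   ones, since integers are invertible. *)
Lemma linear_ode_unique F f g :
  f 0%N = g 0%N -> sderiv f = F * f -> sderiv g = F * g -> f = g.
Proof.
move=> fg0 df dg; apply: seriesP => n; elim/ltn_ind: n => -[|n] IH //.
apply: (@mulrSnI _ _ n).
have := congr1 (fun h : series A => h n) df; rewrite /= {1}/sderiv => ->.
have := congr1 (fun h : series A => h n) dg; rewrite /= {1}/sderiv => ->.
by rewrite ![F * _]mulrC; apply: eq_fps_mulr => i; rewrite -ltnS; apply: IH.
Qed.

(** * Composition of series *)

(* The composite \sum_k c_k f^k; the truncation is harmless for f with constant
   term 0. *)
Definition scomp (c : nat -> A) f : series A :=
  fun n => \sum_(k < n.+1) c k * (f ^+ k) n.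

(** Powers beyond n do not reach degree n, so one polynomial in f serves all degrees up to N. *)
Lemma scomp_trunc c f N n : f 0%N = 0 -> (n <= N)%N ->
  scomp c f n = (\sum_(k < N.+1) sconst (c k) * f ^+ k) n.
Proof.
move=> f0 nN; rewrite series_sum /scomp.
rewrite (big_ord_widen N.+1 (fun k => c k * (f ^+ k) n)) //.
rewrite [LHS]big_mkcond; apply: eq_bigr => k _; rewrite sconstM.
by case: ltnP => // nk; rewrite expr_low ?mulr0.
Qed.

Lemma scomp0 c f : scomp c f 0%N = c 0%N.
Proof. by rewrite /scomp big_ord1 expr0 mulr1. Qed.

Lemma eq_scomp c c' f : c =1 c' -> scomp c f = scomp c' f.
Proof. by move=> cc; apply: seriesP => n; apply: eq_bigr => k _; rewrite cc. Qed.

Lemma scompB c c' f : scomp c f - scomp c' f = scomp (fun k => c k - c' k) f.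
Proof.
apply: seriesP => n; rewrite seriesB /scomp -sumrB.
by apply: eq_bigr => k _; rewrite mulrBl.
Qed.

Lemma scompZ a c f : sconst a * scomp c f = scomp (fun k => a * c k) f.
Proof.
apply: seriesP => n; rewrite sconstM /scomp mulr_sumr.
by apply: eq_bigr => k _; rewrite mulrA.
Qed.

(** Together with [scompB] and [scompZ], this turns an equation for (1 - f) times a composite into a
    recurrence on coefficients. *)
Lemma scomp_shift c f : f 0%N = 0 ->
  f * scomp c f = scomp (fun k => if k is j.+1 then c j else 0) f.
Proof.
move=> f0; apply: seriesP => n; rewrite mulrC.
rewrite (@eq_fps_mulr _ (\sum_(k < n.+1) sconst (c k) * f ^+ k)); last first.
  by move=> i; apply: scomp_trunc.
(* The truncation on the right keeps one more term, since the powers of f are shifted by one. *)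
rewrite (@scomp_trunc _ _ n.+1) // [in RHS]big_ord_recl /= rmorph0 mul0r add0r mulr_suml.
congr (_ n); apply: eq_bigr => k _.
by rewrite exprSr mulrA.
Qed.

Lemma sderiv_comp c f : f 0%N = 0 ->
  sderiv (scomp c f) = scomp (fun k => c k.+1 *+ k.+1) f * sderiv f.
Proof.
move=> f0; apply: seriesP => n.
rewrite (@eq_fps_mulr _ (\sum_(k < n.+1) sconst (c k.+1 *+ k.+1) * f ^+ k));
  last by move=> i; apply: scomp_trunc.
(* Degree n of the derivative reads degree n + 1, hence the longer truncation. *)
transitivity (sderiv (\sum_(k < n.+2) sconst (c k) * f ^+ k) n).
  by rewrite /sderiv (@scomp_trunc _ _ n.+1).
rewrite raddf_sum big_ord_recl mulr_suml /= expr0 mulr1 sderiv_const add0r.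
congr (_ n); apply: eq_bigr => k _.
rewrite sderivM sderiv_const mul0r add0r sderiv_exp rmorphMn /= mulrnAr mulrA.
by rewrite !mulrnAl.
Qed.

(** * Inverse, exponential and logarithm *)

Lemma fps_invE f : fps_inv f = scomp (fun=> 1) (1 - f).
Proof.
by apply: seriesP => n; apply: eq_bigr => k _; rewrite mul1r exp_natE.
Qed.

Lemma fps_expE f : fps_exp f = scomp (fun k => (k`!%:R^-1 : rat)%:A) f.
Proof.
by apply: seriesP => n; apply: eq_bigr => k _; rewrite mulr_algl exp_natE.
Qed.

Lemma fps_logE f : fps_log f =
  scomp (fun k => if k is j.+1 then ((-1) ^+ j / j.+1%:R : rat)%:A else 0) (f - 1).
Proof.
apply: seriesP => n; rewrite /scomp big_ord_recl mul0r add0r /fps_log.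
rewrite big_add1 big_mkord; apply: eq_bigr => k _.
by rewrite mulr_algl exp_natE exprS exprSr mulrN1 mulN1r opprK.
Qed.

Definition sinv f : series A := fps_inv f.

(** A telescoping geometric series: multiplying by 1 - g leaves the coefficients c_k - c_(k-1), all
    0 except the first. *)
Lemma mulVs f : f 0%N = 1 -> sinv f * f = 1.
Proof.
move=> f1; set g : series A := 1 - f; have -> : f = 1 - g by rewrite /g; ring.
have g0 : g 0%N = 0 by rewrite /g seriesB f1 subrr.
rewrite /sinv fps_invE opprB addrC subrK mulrBr mulr1 [_ * g]mulrC scomp_shift //.
rewrite scompB; apply: seriesP => n; rewrite /scomp big_ord_recl /= subr0 mul1r.
by rewrite big1 ?addr0 // => k _; rewrite subrr mul0r.
Qed.

Lemma sderiv_fps_exp f : f 0%N = 0 -> sderiv (fps_exp f) = sderiv f * fps_exp f.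
Proof.
move=> f0; rewrite fps_expE sderiv_comp // mulrC; congr (_ * _).
apply: eq_scomp => k; rewrite -scaler_nat scalerA factS natrM invfM mulrA.
by rewrite divff ?mul1r // pnatr_eq0.
Qed.

(** Differentiating the logarithm series gives the geometric series in 1 - f, which is the inverse
    of f; multiplying by f avoids writing that inverse. *)
Lemma sderiv_fps_log f : f 0%N = 1 -> sderiv (fps_log f) * f = sderiv f.
Proof.
move=> f1; set g : series A := f - 1.
have g0 : g 0%N = 0 by rewrite /g seriesB f1 subrr.
rewrite fps_logE sderiv_comp // -/g.
rewrite (@eq_scomp _ (fun k => (-1) ^+ k)); last first.
  move=> k; rewrite -scaler_nat scalerA mulrCA divff ?pnatr_eq0 // mulr1.
  by rewrite -in_algE rmorphXn rmorphN1.
rewrite mulrAC (_ : sderiv g = sderiv f); last first.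
  by rewrite raddfB /= sderiv1 subr0.
rewrite (_ : _ * f = 1) ?mul1r //.
have -> : f = 1 + g by rewrite /g; ring.
rewrite mulrDr mulr1 [_ * g]mulrC scomp_shift //.
apply: seriesP => n; rewrite seriesD /scomp -big_split big_ord_recl /=.
rewrite mul0r addr0 mul1r big1 ?addr0 // => k _.
by rewrite exprS mulN1r mulNr addNr.
Qed.

Lemma fps_exp0 f : fps_exp f 0%N = 1.
Proof. by rewrite fps_expE scomp0 fact0 invr1 scale1r. Qed.

Lemma fps_log0 f : fps_log f 0%N = 0.
Proof. by rewrite fps_logE scomp0. Qed.

Lemma sderiv_fps_int f : sderiv (fps_int f) = f.
Proof.
apply: seriesP => n; rewrite /sderiv /= -scaler_nat scalerA divff ?scale1r //.
by rewrite pnatr_eq0.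
Qed.

End SeriesRing.

(** * The logarithm in the second equality, and the series (1 - w)^(-u) *)

Section Closed.
Variable A : comAlgType rat.
Implicit Types (f g : series A) (u : A) (n k : nat).

Lemma sderiv_inv f : f 0%N = 1 -> sderiv (sinv f) = - sderiv f * sinv f ^+ 2.
Proof.
move=> f1; have fV := mulVs f1.
have : sderiv (sinv f * f) = 0 by rewrite fV sderiv1.
rewrite sderivM => /eqP; rewrite addr_eq0 => /eqP dV.
transitivity (sderiv (sinv f) * (sinv f * f)); first by rewrite fV mulr1.
by rewrite [sinv f * f]mulrC mulrA dV; ring.
Qed.

Variable u : A.
Local Notation U := (sconst u).
Local Notation S := (svar A).

Lemma sinvM f g : f 0%N = 1 -> g 0%N = 1 -> sinv (f * g) = sinv f * sinv g.
Proof.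
move=> f1 g1; have fV := mulVs f1; have gV := mulVs g1.
have fgV : sinv (f * g) * (f * g) = 1 by apply: mulVs; rewrite series0M f1 g1 mulr1.
transitivity (sinv (f * g) * ((sinv f * f) * (sinv g * g))).
  by rewrite fV gV !mulr1.
transitivity (sinv (f * g) * (f * g) * (sinv f * sinv g)); first by ring.
by rewrite fgV mul1r.
Qed.

Lemma const_term a f : (1 - a * S + f) 0%N = 1 + f 0%N.
Proof. by rewrite seriesD seriesB series0M mulr0 subr0. Qed.

Lemma const_term_lin a : (1 - a * S) 0%N = 1.
Proof. by rewrite seriesB series0M mulr0 subr0. Qed.

(** With a = 1 - us and b = a + s, the logarithmic derivative of b/a is (1 - u)/b + u/a = 1/(ab),
    because (1 - u)a + ub = 1. Both sides have constant term 0. *)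
Lemma int_eq_log :
  fps_int (U * sinv ((1 - U * S) * (1 + S - U * S)))%R =
  U * fps_log ((1 - S * U + S) * sinv (1 - S * U))%R :> series A.
Proof.
set a := 1 - U * S; set b := 1 + S - U * S.
have -> : 1 - S * U + S = b by rewrite /b; ring.
have -> : 1 - S * U = a by rewrite /a; ring.
have a1 : a 0%N = 1 by apply: const_term_lin.
have b1 : b 0%N = 1.
  by rewrite /b addrAC const_term addr0.
have aV := mulVs a1; have bV := mulVs b1.
have r1 : (b * sinv a) 0%N = 1.
  have := congr1 (fun f : series A => f 0%N) aV.
  by rewrite !series0M a1 b1 mulr1 mul1r.
apply: sderiv_inj; first by rewrite series0M fps_log0 mulr0.
rewrite sderiv_fps_int sderivM sderiv_const mul0r add0r; congr (_ * _).
have dL := sderiv_fps_log r1.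
rewrite sderivM sderiv_inv // in dL.
have da : sderiv a = - U.
  by rewrite /a raddfB /= sderiv1 sderivM sderiv_const sderiv_var; ring.
have db : sderiv b = 1 - U.
  by rewrite /b raddfB raddfD /= sderiv1 sderivM sderiv_const sderiv_var; ring.
rewrite da db in dL.
rewrite sinvM //; set L := sderiv _ in dL *.
(* [ring] treats [sinv a] and [sinv b] as atoms, so each cancellation with a or b is inserted by
   hand. *)
transitivity (L * (sinv b * b) * (sinv a * a)); last by rewrite aV bV !mulr1.
transitivity (L * (b * sinv a) * (sinv b * a)); last by ring.
rewrite {}dL.
transitivity ((1 - U) * sinv b * (sinv a * a) +
              U * (sinv b * b) * (sinv a * a) * sinv a); last by ring.
rewrite aV bV !mulr1.
transitivity ((1 - U) * sinv b * (sinv a * a) + U * (sinv b * b) * sinv a);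
  last by rewrite aV bV !mulr1.
by rewrite /a /b; ring.
Qed.

(** The coefficient u(u+1)...(u+k-1)/k! of w^k in (1 - w)^(-u). *)
Definition rising k : A := (k`!%:R^-1 : rat)%:A * \prod_(i < k) (u + i%:R).

Lemma rising0 : rising 0 = 1.
Proof. by rewrite /rising big_ord0 mulr1 fact0 invr1 scale1r. Qed.

Lemma risingS k : rising k.+1 *+ k.+1 = (u + k%:R) * rising k.
Proof.
have factV : (k.+1`!%:R^-1 : rat)%:A *+ k.+1 = (k`!%:R^-1 : rat)%:A :> A.
  rewrite -scaler_nat scalerA factS natrM invfM mulrA.
  by rewrite divff ?mul1r // pnatr_eq0.
by rewrite /rising big_ord_recr /= -mulrnAl factV; ring.
Qed.

Definition wser : series A := S * sinv (1 - (U - 1) * S).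

Lemma wser_eq : wser = S + (U - 1) * S * wser.
Proof.
have qV := mulVs (const_term_lin (U - 1)); set q := 1 - (U - 1) * S in qV.
have -> : (U - 1) * S = 1 - q by rewrite /q; ring.
rewrite /wser -/q.
rewrite mulrBl mul1r mulrCA [q * _]mulrC qV; ring.
Qed.

Lemma wser0 : wser 0%N = 0.
Proof. by rewrite /wser series0M mul0r. Qed.

(** The equation w = s + (u - 1)sw yields a recurrence for the coefficients of the powers of w,
    which is Pascal's rule weighted by u - 1. *)
Lemma wser_exp k n :
  (wser ^+ k.+1) n.+1 = (u - 1) ^+ (n - k) *+ 'C(n, k).
Proof.
have rec j i : (wser ^+ j.+1) i.+1 = (u - 1) * (wser ^+ j.+1) i + (wser ^+ j) i.
  rewrite {1}exprS {1}wser_eq mulrDl.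
  have -> : S * wser ^+ j + (U - 1) * S * wser * wser ^+ j =
    S * (sconst (u - 1) * wser ^+ j.+1 + wser ^+ j).
    by rewrite exprS rmorphB rmorph1; ring.
  by rewrite svarM seriesD sconstM.
elim: n k => [|n IH] k; rewrite rec.
  rewrite expr_low ?wser0 // mulr0 add0r sub0n expr0.
  by case: k => [|k]; rewrite ?bin0n // expr_low ?wser0.
case: k => [|k]; first by rewrite IH addr0 !subn0 !bin0 !mulr1n exprS.
rewrite !IH binS subSS mulrnDr; congr (_ + _).
(* For k >= n the binomial vanishes, so the truncated exponents need to agree only when k < n. *)
case: (ltnP k n) => kn; last by rewrite bin_small // !mulr0n mulr0.
by rewrite mulrnAr -exprS; congr (_ ^+ _ *+ _); lia.
Qed.

Definition closed : series A := scomp rising wser.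

(* [closed] is (1 - w)^(-u), by the binomial series. *)
Lemma sderiv_closed :
  sderiv closed = U * sinv ((1 - U * S) * (1 + S - U * S)) * closed.
Proof.
have qV := mulVs (const_term_lin (U - 1)); set q := 1 - (U - 1) * S in qV.
(* Here q - s = 1 - us and q = 1 + s - us. *)
have -> : (1 - U * S) * (1 + S - U * S) = (q - S) * q by rewrite /q; ring.
have qS1 : (q - S) 0%N = 1.
  by rewrite const_term seriesN oppr0 addr0.
have q1 : q 0%N = 1 by apply: const_term_lin.
have rV := mulVs qS1.
have dw : sderiv wser = sinv q ^+ 2.
  have dq : sderiv q = 1 - U.
    rewrite /q raddfB /= sderiv1 sderivM sderiv_var.
    by rewrite -(rmorph1 (@sconst A)) -rmorphB /= sderiv_const rmorphB /=; ring.
  rewrite /wser -/q sderivM sderiv_var sderiv_inv // dq.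
  transitivity (sinv q * (sinv q * q) + S * (U - 1) * sinv q ^+ 2); last first.
    by rewrite /q; ring.
  by rewrite qV; ring.
rewrite /closed sderiv_comp ?wser0 // dw.
set H := scomp _ wser; set G := scomp rising wser.
(* This is (1 - w)F'(w) = u F(w) for the binomial series F; on coefficients it reads (k+1)r_(k+1) -
   k r_k = u r_k, which is [risingS]. *)
have GH : (1 - wser) * H = U * G.
  rewrite mulrBl mul1r scomp_shift ?wser0 // scompB scompZ; apply: eq_scomp => k.
  case: k => [|k]; first by rewrite subr0 risingS addr0.
  by rewrite (risingS k.+1) -[rising k.+1 *+ k.+1]mulr_natl -mulrBl addrK.
have w1 : 1 - wser = (q - S) * sinv q.
  by rewrite mulrBl [q * _]mulrC qV.
(* Since w' = 1/q^2 and 1/(1 - w) = q/(q - s), the chain rule produces the factor u/((q - s)q). *)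
transitivity ((sinv (q - S) * (q - S)) * H * sinv q ^+ 2).
  by rewrite rV mul1r.
transitivity (sinv (q - S) * sinv q * ((1 - wser) * H)).
  by rewrite w1; ring.
by rewrite GH sinvM //; ring.
Qed.
End Closed.

(** * Counting multichains below a lattice point *)

Lemma hockey_stick k N : (\sum_(j < N) 'C(j + k, k) = 'C(N + k, k.+1))%N.
Proof.
elim: N => [|N IH]; first by rewrite big_ord0 bin_small.
by rewrite big_ord_recr /= IH addSn binS.
Qed.

(** The constraints bound sums of coordinates from above, so the lattice points form a down-set and
    the interval below x is a full box. *)
Lemma coords_le_polytope n (t : arbor n) (x y : {ffun 'I_n -> 'I_n.+1}) :
  (forall i, (y i <= x i)%N) -> polytope t (coords x) -> polytope t (coords y).
Proof.
move=> yx /andP[_ xD]; apply/andP; split.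
  by apply/forallP => i; rewrite mxE.
apply: sub_all xD => v; apply: le_trans.
by apply: ler_sum => i _; rewrite !mxE lez_nat.
Qed.

(** The interval below x is a product of chains, so its multichains are counted one coordinate at a
    time by the hockey-stick identity. *)
Lemma nb_chains_lattice n (t : arbor n) k (x : lattice_point t) :
  nb_chains (@lattice_le n t) k x = (\prod_i 'C(val x i + k, k))%N.
Proof.
elim: k x => [|k IH] x; first by rewrite big1 // => i _; rewrite bin0.
rewrite /=; under eq_bigr => y _ do rewrite IH.
pose Q (i : 'I_n) := [pred j : 'I_n.+1 | j <= val x i]%N.
transitivity (\sum_(y in family Q) \prod_i 'C(y i + k, k))%N.
  rewrite -(big_sub_cond (fun y => polytope t (coords y))
    (fun y => [forall i, (y i <= val x i)%N]) (fun y => \prod_i 'C(y i + k, k))%N).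
  apply: eq_bigl => y; rewrite andb_idl // => /forallP yx.
  exact: coords_le_polytope yx (valP x).
transitivity (\prod_i \sum_(j : 'I_n.+1 | Q i j) 'C(j + k, k))%N.
  by rewrite bigA_distr_big_dep.
apply: eq_bigr => i _.
have := hockey_stick k (val x i).+1; rewrite addSnnS => <-.
exact/esym/(big_ord_widen n.+1 (fun j => 'C(j + k, k))).
Qed.

Lemma zeta_poly_eval n (t : arbor n) k :
  (zeta_poly t).[1].[k.+2%:R] =
  (\sum_(x : lattice_point t) \prod_i 'C(val x i + k, k))%:R.
Proof.
rewrite -[LHS]/(horner_eval _ _) -horner_map rmorph1 zeta_polyP.
rewrite (chain_sum (@lattice_le n t) k (fun x => 'X^(height x))) horner_sum natr_sum.
apply: eq_bigr => x _.
by rewrite hornerMn hornerXn expr1n nb_chains_lattice.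
Qed.

(** * Lattice points of the corolla, counted by height *)

Lemma polytope_corolla p (x : {ffun 'I_p.+1 -> 'I_p.+2}) :
  polytope (corolla p) (coords x) =
  [forall i : 'I_p, (x (lift ord_max i) <= 1)%N] && (\sum_i x i <= p.+1)%N.
Proof.
have leaves : subtrees (corolla_tree p) =
    corolla_tree p :: [seq Node [set lift ord_max i] [::] | i <- enum 'I_p].
  by rewrite /=; congr (_ :: _); elim: (enum 'I_p) => //= i r ->.
have root : labels_below (corolla_tree p) = [set: 'I_p.+1].
  apply/setP => i; rewrite /labels_below corolla_decorations big_cons big_map.
  rewrite big_enum /= !inE; case: (unliftP ord_max i) => [j|] ->; last first.
    by rewrite eqxx.
  by apply/orP; right; apply/bigcupP; exists j; rewrite // set11.
have -> : polytope (corolla p) (coords x) = all (fun v => \sum_(i in labels_below v)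
    coords x 0 i <= #|labels_below v|%:R) (subtrees (corolla_tree p)).
  by rewrite /polytope andb_idl // => _; apply/forallP => i; rewrite mxE.
rewrite leaves /= root cardsT card_ord all_map andbC; congr (_ && _).
  have leaf i : labels_below (Node [set lift ord_max i] [::]) =
      [set lift ord_max i] :> {set 'I_p.+1}.
    by rewrite /labels_below big_seq1.
  apply/allP/forallP => H i; have := H i; rewrite /= ?mem_enum leaf cards1.
    by rewrite big_set1 mxE; apply.
  by rewrite big_set1 mxE.
rewrite (eq_bigr (fun i => (x i)%:R)); last by move=> i _; rewrite mxE natz.
rewrite -natr_sum ler_nat; congr (_ <= _)%N; apply: eq_bigl => i; exact: in_setT.
Qed.

(** When X marks the height, each leaf coordinate contributes 1 + (k + 1)X and the root coordinate
    contributes [B]; the bound on the height keeps the coefficients of degree at most p + 1, and j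
    counts the leaves with value 1. *)
Lemma sum_corolla p k :
  (\sum_(x : lattice_point (corolla p)) \prod_i 'C(val x i + k, k))%N =
  (\sum_(j < p.+1) 'C(p, j) * k.+1 ^ j * 'C(p - j + k.+2, k.+1))%N.
Proof.
apply/eqP; rewrite -(eqr_nat rat); apply/eqP.
(* [Q] imposes only the leaf bounds; the bound on the sum is restored by summing over d < p + 2. *)
pose Q (i : 'I_p.+1) := [pred j : 'I_p.+2 | (i == ord_max) || (j <= 1)%N].
pose w (x : {ffun 'I_p.+1 -> 'I_p.+2}) : rat := (\prod_i 'C(x i + k, k))%:R.
pose B : {poly rat} := \poly_(c < p.+2) 'C(c + k, k)%:R.
have famE (x : {ffun 'I_p.+1 -> 'I_p.+2}) :
    (x \in family Q) = [forall i : 'I_p, (x (lift ord_max i) <= 1)%N].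
  apply/familyP/forallP => H i.
    by have := H (lift ord_max i); rewrite inE eq_sym (negPf (neq_lift _ _)).
  by rewrite inE; case: (unliftP ord_max i) => [j|] ->; rewrite ?eqxx // H orbT.
have gen : \sum_(x in family Q) w x *: 'X^(\sum_i x i) =
    (k.+1%:R *: 'X + 1) ^+ p * B.
  transitivity (\prod_i \sum_(j | Q i j) 'C(j + k, k)%:R *: 'X^j : {poly rat}).
    rewrite bigA_distr_big_dep; apply: eq_bigr => x _.
    by rewrite /w natr_prod expr_sum scaler_prod.
  rewrite big_ord_recr /=; congr (_ * _); last first.
    by rewrite /B poly_def; apply: eq_bigl => j; rewrite eqxx.
  rewrite -[p in RHS]card_ord -prodr_const; apply: eq_big => // i _.
  have iN : (widen_ord (leqnSn p) i == ord_max) = false.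
    by rewrite -val_eqE /= ltn_eqF.
  rewrite big_mkcond big_ord_recl big_ord_recl /= iN /= /bump /=.
  by rewrite big1 // addr0 add0n binn scale1r binSn addrC.
transitivity (\sum_(d < p.+2) ((k.+1%:R *: 'X + 1) ^+ p * B)`_d).
  rewrite -gen; under [RHS]eq_bigr => d _ do rewrite coef_sum.
  rewrite natr_sum exchange_big /=.
  rewrite -(big_sub (fun y => polytope (corolla p) (coords y)) w).
  rewrite big_mkcond [RHS]big_mkcond; apply: eq_bigr => x _.
  (* A point within the bound contributes its weight to exactly one coefficient d, a point beyond it
     to none. *)
  rewrite [in LHS]unfold_in polytope_corolla -famE; case: ifP => /= [/andP[-> xp]|].
    rewrite (bigD1 (Ordinal (xp : (_ < p.+2)%N))) //= coefZ coefXn eqxx mulr1.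
    rewrite big1 ?addr0 // => d; rewrite -val_eqE /= => nd.
    by rewrite coefZ coefXn (negPf nd) mulr0.
  case: (x \in _) => //= xp; rewrite big1 // => d _; rewrite coefZ coefXn.
  case: eqP => [E|]; rewrite ?mulr0 //; by move: xp; rewrite -E -ltnS ltn_ord.
rewrite [_ *: 'X + 1]addrC exprDn natr_sum mulr_suml.
under [LHS]eq_bigr => d _ do rewrite coef_sum.
rewrite exchange_big; apply: eq_bigr => j _ /=.
under eq_bigr => d _.
  rewrite expr1n mul1r exprZn mulrnAl -scalerAl coefMn coefZ coefXnM; over.
rewrite sumrMnl -mulr_sumr -[LHS]mulr_natl !natrM natrX mulrA; congr (_ * _).
have jp : (j <= p.+2)%N by rewrite ltnW // ltnW // ltnS.
rewrite -(big_mkord xpredT (fun d => if (d < j)%N then 0 else B`_(d - j))).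
rewrite (big_cat_nat _ jp) //= big_nat big1 ?add0r => [|d /andP[_ ->]] //.
rewrite -[X in \sum_(X <= _ < _) _]add0n big_addn big_mkord.
transitivity (\sum_(d < p.+2 - j) 'C(d + k, k)%:R : rat).
  apply: eq_bigr => d _; rewrite ltnNge leq_addl addnK coef_poly ifT //.
  exact: leq_trans (ltn_ord d) (leq_subr _ _).
rewrite -natr_sum hockey_stick; congr ('C(_, _)%:R); have := ltn_ord j; lia.
Qed.

(** * Identification of the zeta series with the closed form *)

Lemma poly_natr_inj (p q : {poly rat}) :
  (forall k, p.[k.+2%:R] = q.[k.+2%:R]) -> p = q.
Proof.
move=> pq; apply/eqP; rewrite -subr_eq0; apply/eqP.
pose s := [seq (k.+2%:R : rat) | k <- iota 0 (size (p - q))].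
apply: (@roots_geq_poly_eq0 _ _ s); last by rewrite size_map size_iota.
  by apply/allP => _ /mapP[k _ ->]; rewrite rootE hornerD hornerN subr_eq0 pq.
rewrite map_inj_uniq ?iota_uniq // => j k /eqP.
by rewrite eqr_nat => /eqP[].
Qed.

Lemma rising_eval m k : (rising ('X : {poly rat}) k).[m.+1%:R] = 'C(m + k, k)%:R.
Proof.
elim: k => [|k IH]; first by rewrite rising0 bin0 hornerC.
have k_neq0 : k.+1%:R != 0 :> rat by rewrite pnatr_eq0.
apply: (mulIf k_neq0); rewrite mulr_natr -hornerMn risingS hornerM IH.
rewrite !hornerE -polyC_natr hornerC -natrD -!natrM; congr _%:R.
by rewrite [RHS]mulnC -mul_bin_diag addnS /= addSn.
Qed.

(** Coefficients are polynomials in u, so comparing their values at u = k + 2 suffices. *)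
Lemma zeta_series_closed : zeta_series =1 closed ('X : {poly rat}).
Proof.
case=> [|p]; first by rewrite /closed scomp0 rising0.
apply: poly_natr_inj => k; rewrite zeta_poly_eval sum_corolla.
rewrite /closed /scomp [in RHS]big_ord_recl expr0 mulr0 add0r horner_sum natr_sum.
(* Reversing the sum matches the number of leaves with value 1 to the exponent p - j of u - 1 in
   [wser_exp]. *)
rewrite [LHS](reindex_inj rev_ord_inj); apply: eq_bigr => j _ /=.
have jp : (j <= p)%N := leq_ord j.
rewrite subSS wser_exp hornerM rising_eval hornerMn horner_exp.
rewrite hornerD hornerN hornerX hornerC bin_sub // subKn //.
have -> : k.+2%:R - 1 = k.+1%:R :> rat by rewrite -[k.+2]addn1 natrD addrK.
rewrite -natrX -[_ *+ 'C(p, j)]mulr_natl -!natrM mulnC; congr (_ * _)%:R.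
by rewrite -[RHS]bin_sub ?leq_addl // addnK /bump add1n addnC addnS addSn.
Qed.

Theorem theorem2p2 :
  let u : fps {poly rat} := fps_const 'X in
  let s : fps {poly rat} := fps_var {poly rat} in
  zeta_series =1 fps_exp (fps_int (u / ((1 - u * s) * (1 + s - u * s)))%fps)
  /\
  fps_exp (fps_int (u / ((1 - u * s) * (1 + s - u * s)))%fps)
    =1 fps_pow ((1 - s * u + s) / (1 - s * u))%fps 'X.
Proof.
move=> u s.
set E := (u / _)%fps; split; last first.
  have EL := int_eq_log ('X : {poly rat}).
  by move=> n; rewrite /fps_pow; congr (fps_exp _ n); apply: EL.
move=> n; rewrite zeta_series_closed; congr (_ n).
(* Both series have constant term 1 and satisfy y' = E y. *)
apply: (@linear_ode_unique _ E); last 1 first.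
- by rewrite sderiv_fps_exp // sderiv_fps_int.
- by rewrite fps_exp0 /closed scomp0 rising0.
- exact: sderiv_closed.
Qed.
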